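(* Let $k\to A$ be an arbitrary map of unital commutative rings, let $f\in Z^2(\mathrm{Der}_k(A),A)$, and for an $A/k$-Lie-Rinehart algebra $(L,\alpha)$ let $\alpha^*(f)\in Z^2(L,A)$ be the pull back of $f$ via $\alpha$. There is a covariant functor $F$ from the category of $A/k$-Lie-Rinehart algebras to the category of $D^1_f(A)$-Lie algebras, defined by $$F(L,\alpha):=(L(\alpha^*(f)),\alpha_f,\pi_f,[,],z).$$ A map $\phi:(L,\alpha)\to(L',\alpha')$ of Lie-Rinehart algebras gives a map $\phi_f:L(\alpha^*(f))\to L'(\alpha'^*(f))$ of $D^1_f(A)$-Lie algebras; in particular $\phi_f(z)=z'$, with $z,z'$ the central elements of $L(\alpha^*(f))$ and $L'(\alpha'^*(f))$. The construction is functorial: if $\phi':(L',\alpha')\to(L'',\alpha'')$ is another map of Lie-Rinehart algebras then $(\phi'\circ\phi)_f=\phi'_f\circ\phi_f$.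
   Context: An $A\otimes_kA$-module $M$ is regarded as having commuting left and right actions $am=(a\otimes 1)m$, $ma=(1\otimes a)m$. A 2-cocycle $f\in Z^2(\mathrm{Der}_k(A),A)$ is an alternating $A$-bilinear map with $x(f(y,z))-y(f(x,z))+z(f(x,y))-f([x,y],z)+f([x,z],y)-f([y,z],x)=0$. $D^1_f(A)=A\oplus\mathrm{Der}_k(A)$, with elements $aI+x$, has actions $c(aI+x)=(ca)I+cx$, $(aI+x)c=(ac+x(c))I+cx$, bracket $[aI+x,bI+y]=(x(b)-y(a)+f(x,y))I+[x,y]$, and projection $\pi(aI+x)=x$. $\mathrm{Der}_k(A)$ carries the trivial right $A$-module structure (right action equal to left action). A $D^1_f(A)$-Lie algebra is a 5-tuple $(\tilde L,\tilde\alpha,\tilde\pi,[,],D)$ where $\tilde L$ is an $A\otimes_kA$-module and a $k$-Lie algebra, $\tilde\alpha:\tilde L\to D^1_f(A)$ and $\tilde\pi:\tilde L\to\mathrm{Der}_k(A)$ are maps of $A\otimes_kA$-modules and $k$-Lie algebras with $\pi\circ\tilde\alpha=\tilde\pi$, $D\in\tilde L$ is central for the Lie bracket, $\tilde\pi(D)=0$, and for all $u,v\in\tilde L$, $c\in A$: $uc=cu+\tilde\pi(u)(c)D$ and $[u,cv]=c[u,v]+\tilde\pi(u)(c)v$. A morphism $(\tilde L,\tilde\alpha,\tilde\pi,[,],D)\to(\tilde M,\tilde\beta,\tilde\gamma,[,],D')$ is a map $\psi$ of $k$-Lie algebras and $A\otimes_kA$-modules with $\tilde\beta\circ\psi=\tilde\alpha$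 and $\psi(D)=D'$. An $A/k$-Lie-Rinehart algebra $(L,\alpha)$ is a $k$-Lie algebra and left $A$-module $L$ with a map $\alpha:L\to\mathrm{Der}_k(A)$ of $A$-modules and $k$-Lie algebras such that $[x,uy]=u[x,y]+\alpha(x)(u)y$; morphisms are maps of $A$-modules and $k$-Lie algebras compatible with the maps to $\mathrm{Der}_k(A)$. $\alpha^*(f)(x,y)=f(\alpha(x),\alpha(y))$. $L(\alpha^*(f)):=Az\oplus L$ (with $Az$ free on $z$) has left action $b(az+x)=(ba)z+bx$, right action $(az+x)b=(ab+\alpha(x)(b))z+bx$, bracket $[az+x,bz+y]=(\alpha(x)(b)-\alpha(y)(a)+\alpha^*(f)(x,y))z+[x,y]$, and maps $\alpha_f(az+x)=aI+\alpha(x)$, $\pi_f(az+x)=\alpha(x)$. For $\phi:(L,\alpha)\to(L',\alpha')$, $\phi_f(az+x)=az'+\phi(x)$. *)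

(* Defs.v *)
From HB Require Import structures.
From mathcomp Require Import all_boot all_algebra.
From mathcomp Require Import boolp.
From mathcomp Require Import ring.

Set Implicit Arguments.
Unset Strict Implicit.
Unset Printing Implicit Defensive.

Import GRing.Theory.
Local Open Scope ring_scope.

Record category := Category {
  obj :> Type;
  hom : obj -> obj -> Type;
  idm : forall X, hom X X;
  comp : forall X Y Z, hom Y Z -> hom X Y -> hom X Z;
  comp_idl : forall X Y (g : hom X Y), comp (idm Y) g = g;
  comp_idr : forall X Y (g : hom X Y), comp g (idm X) = g;
  compA : forall X Y Z T (h : hom Z T) (g : hom Y Z) (e : hom X Y),
    comp h (comp g e) = comp (comp h g) e
}.

Record is_functor (C D : category) (F0 : C -> D)
    (F1 : forall X Y : C, hom X Y -> hom (F0 X) (F0 Y)) : Prop := IsFunctor {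
  functor_id : forall X, F1 X X (idm X) = idm (F0 X);
  functor_comp : forall (X Y Z : C) (h : hom Y Z) (g : hom X Y),
    F1 X Z (comp h g) = comp (F1 Y Z h) (F1 X Y g)
}.

(* The ground ring [k] acts on every A-module through the structure map
   [iota : k -> A]; no separate k-module structure is carried. In particular
   an A-linear map is k-linear. *)

Definition klinear (k A : comPzRingType) (iota : {rmorphism k -> A})
    (V W : lmodType A) (g : V -> W) : Prop :=
  (forall u v, g (u + v) = g u + g v) /\
  (forall c u, g (iota c *: u) = iota c *: g u).

Record is_lie_algebra (k A : comPzRingType) (iota : {rmorphism k -> A})
    (V : lmodType A) (br : V -> V -> V) : Prop := IsLieAlgebra {
  lie_linearl : forall v, klinear iota (fun u => br u v);
  lie_linearr : forall u, klinear iota (br u);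
  lie_alternating : forall u, br u u = 0;
  lie_jacobi : forall u v w,
    br u (br v w) + br v (br w u) + br w (br u v) = 0
}.

Definition is_lie_hom (k A : comPzRingType) (iota : {rmorphism k -> A})
    (V W : lmodType A) (brV : V -> V -> V) (brW : W -> W -> W)
    (g : V -> W) : Prop :=
  klinear iota g /\ forall u v, g (brV u v) = brW (g u) (g v).

(* An (A (x)_k A)-module is a left A-module with a commuting right A-action
   such that the two induced actions of k coincide. *)
Record is_bimodule (k A : comPzRingType) (iota : {rmorphism k -> A})
    (V : lmodType A) (ract : V -> A -> V) : Prop := IsBimodule {
  ract_Dl : forall u v c, ract (u + v) c = ract u c + ract v c;
  ract_Dr : forall u c d, ract u (c + d) = ract u c + ract u d;
  ract_1 : forall u, ract u 1 = u;
  ract_M : forall u c d, ract u (c * d) = ract (ract u c) d;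
  ract_comm : forall c u d, ract (c *: u) d = c *: ract u d;
  ract_iota : forall (c : k) u, ract u (iota c) = iota c *: u
}.

Definition is_bimodule_hom (A : comPzRingType) (V W : lmodType A)
    (rV : V -> A -> V) (rW : W -> A -> W) (g : V -> W) : Prop :=
  linear g /\ forall u c, g (rV u c) = rW (g u) c.

Record is_derivation (k A : comPzRingType) (iota : {rmorphism k -> A})
    (x : A -> A) : Prop := IsDerivation {
  derivationD : forall a b, x (a + b) = x a + x b;
  derivationZ : forall c a, x (iota c * a) = iota c * x a;
  derivationM : forall a b, x (a * b) = x a * b + a * x b
}.

Record Der (k A : comPzRingType) (iota : {rmorphism k -> A}) := MkDer {
  der_fun :> A -> A;
  derP : is_derivation iota der_fun
}.

Lemma der_ext (k A : comPzRingType) (iota : {rmorphism k -> A})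
  (x y : Der iota) : (forall a, x a = y a) -> x = y.
Proof.
case: x y => [x xP] [y yP] /= /funext exy.
rewrite exy in xP *.
by congr MkDer; apply: Prop_irrelevance.
Qed.

Lemma der0_subproof (k A : comPzRingType) (iota : {rmorphism k -> A}) :
  is_derivation iota (fun=> 0).
Proof. by split=> *; ring. Qed.

Lemma der_opp_subproof (k A : comPzRingType) (iota : {rmorphism k -> A})
  (x : Der iota) : is_derivation iota (fun a => - x a).
Proof. by case: x => x [xD xZ xM]; split=> * /=; rewrite ?(xD, xZ, xM); ring. Qed.

Lemma der_add_subproof (k A : comPzRingType) (iota : {rmorphism k -> A})
  (x y : Der iota) : is_derivation iota (fun a => x a + y a).
Proof.
case: x y => x [xD xZ xM] [y [yD yZ yM]].
by split=> * /=; rewrite ?(xD, xZ, xM, yD, yZ, yM); ring.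
Qed.

Lemma der_scale_subproof (k A : comPzRingType) (iota : {rmorphism k -> A})
  (c : A) (x : Der iota) : is_derivation iota (fun a => c * x a).
Proof. by case: x => x [xD xZ xM]; split=> * /=; rewrite ?(xD, xZ, xM); ring. Qed.

Lemma der_bracket_subproof (k A : comPzRingType) (iota : {rmorphism k -> A})
  (x y : Der iota) : is_derivation iota (fun a => x (y a) - y (x a)).
Proof.
case: x y => x [xD xZ xM] [y [yD yZ yM]].
by split=> * /=; rewrite ?(xD, xZ, xM, yD, yZ, yM); ring.
Qed.

Definition der0 (k A : comPzRingType) (iota : {rmorphism k -> A}) : Der iota :=
  MkDer (der0_subproof iota).

Definition der_opp (k A : comPzRingType) (iota : {rmorphism k -> A})
  (x : Der iota) : Der iota := MkDer (der_opp_subproof x).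

Definition der_add (k A : comPzRingType) (iota : {rmorphism k -> A})
  (x y : Der iota) : Der iota := MkDer (der_add_subproof x y).

Definition der_scale (k A : comPzRingType) (iota : {rmorphism k -> A})
  (c : A) (x : Der iota) : Der iota := MkDer (der_scale_subproof c x).

Definition der_bracket (k A : comPzRingType) (iota : {rmorphism k -> A})
  (x y : Der iota) : Der iota := MkDer (der_bracket_subproof x y).

HB.instance Definition _ (k A : comPzRingType) (iota : {rmorphism k -> A}) :=
  gen_eqMixin (Der iota).
HB.instance Definition _ (k A : comPzRingType) (iota : {rmorphism k -> A}) :=
  gen_choiceMixin (Der iota).

Lemma der_addA (k A : comPzRingType) (iota : {rmorphism k -> A}) :
  associative (@der_add k A iota).
Proof. by move=> x y z; apply: der_ext => a /=; ring. Qed.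

Lemma der_addC (k A : comPzRingType) (iota : {rmorphism k -> A}) :
  commutative (@der_add k A iota).
Proof. by move=> x y; apply: der_ext => a /=; ring. Qed.

Lemma der_add0r (k A : comPzRingType) (iota : {rmorphism k -> A}) :
  left_id (der0 iota) (@der_add k A iota).
Proof. by move=> x; apply: der_ext => a /=; ring. Qed.

Lemma der_addNr (k A : comPzRingType) (iota : {rmorphism k -> A}) :
  left_inverse (der0 iota) (@der_opp k A iota) (@der_add k A iota).
Proof. by move=> x; apply: der_ext => a /=; ring. Qed.

HB.instance Definition _ (k A : comPzRingType) (iota : {rmorphism k -> A}) :=
  GRing.isZmodule.Build (Der iota)
    (@der_addA k A iota) (@der_addC k A iota)
    (@der_add0r k A iota) (@der_addNr k A iota).

Lemma der_scaleA (k A : comPzRingType) (iota : {rmorphism k -> A})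
  (a b : A) (x : Der iota) :
  der_scale a (der_scale b x) = der_scale (a * b) x.
Proof. by apply: der_ext => c /=; ring. Qed.

Lemma der_scale1r (k A : comPzRingType) (iota : {rmorphism k -> A}) :
  left_id 1 (@der_scale k A iota).
Proof. by move=> x; apply: der_ext => c /=; ring. Qed.

Lemma der_scaleDr (k A : comPzRingType) (iota : {rmorphism k -> A}) :
  right_distributive (@der_scale k A iota) +%R.
Proof. by move=> a x y; apply: der_ext => c /=; ring. Qed.

Lemma der_scaleDl (k A : comPzRingType) (iota : {rmorphism k -> A})
  (x : Der iota) : {morph (@der_scale k A iota)^~ x : a b / a + b}.
Proof. by move=> a b; apply: der_ext => c /=; ring. Qed.

HB.instance Definition _ (k A : comPzRingType) (iota : {rmorphism k -> A}) :=
  GRing.Zmodule_isLmodule.Build A (Der iota)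
    (@der_scaleA k A iota) (@der_scale1r k A iota)
    (@der_scaleDr k A iota) (@der_scaleDl k A iota).

Definition der_ract (k A : comPzRingType) (iota : {rmorphism k -> A})
  (x : Der iota) (c : A) : Der iota := c *: x.

(* [Z2 br alpha f] : f is in Z^2(V, A), where V has bracket [br] and acts on A
   through [alpha]; Z^2(Der_k(A), A) is the case V = Der_k(A), alpha = id. *)
Record Z2 (k A : comPzRingType) (iota : {rmorphism k -> A})
    (V : lmodType A) (br : V -> V -> V) (alpha : V -> Der iota)
    (f : V -> V -> A) : Prop := IsZ2 {
  Z2_linearl : forall y, scalar (fun x => f x y);
  Z2_linearr : forall x, scalar (f x);
  Z2_alternating : forall x, f x x = 0;
  Z2_cocycle : forall x y z,
    alpha x (f y z) - alpha y (f x z) + alpha z (f x y)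
    - f (br x y) z + f (br x z) y - f (br y z) x = 0
}.

Definition pullback (A : comPzRingType) (V W : lmodType A) (alpha : V -> W)
  (f : W -> W -> A) (x y : V) : A := f (alpha x) (alpha y).

(* D^1_f(A): the pair (a, x) stands for aI + x *)

Definition D1 (k A : comPzRingType) (iota : {rmorphism k -> A}) : lmodType A :=
  (A^o * Der iota)%type.

Definition D1_ract (k A : comPzRingType) (iota : {rmorphism k -> A})
  (u : D1 iota) (c : A) : D1 iota := (u.1 * c + u.2 c, c *: u.2).

Definition D1_bracket (k A : comPzRingType) (iota : {rmorphism k -> A})
  (f : Der iota -> Der iota -> A) (u v : D1 iota) : D1 iota :=
  (u.2 v.1 - v.2 u.1 + f u.2 v.2, der_bracket u.2 v.2).

Definition D1_proj (k A : comPzRingType) (iota : {rmorphism k -> A})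
  (u : D1 iota) : Der iota := u.2.

Record DLie_data (k A : comPzRingType) (iota : {rmorphism k -> A}) := DLieData {
  dl_sort :> lmodType A;
  dl_ract : dl_sort -> A -> dl_sort;
  dl_alpha : dl_sort -> D1 iota;
  dl_pi : dl_sort -> Der iota;
  dl_bracket : dl_sort -> dl_sort -> dl_sort;
  dl_D : dl_sort
}.

Record is_DLie (k A : comPzRingType) (iota : {rmorphism k -> A})
    (f : Der iota -> Der iota -> A) (L : DLie_data iota) : Prop := IsDLie {
  dl_bimodule : is_bimodule iota (@dl_ract _ _ _ L);
  dl_lie : is_lie_algebra iota (@dl_bracket _ _ _ L);
  dl_alpha_bimodule :
    is_bimodule_hom (@dl_ract _ _ _ L) (@D1_ract _ _ iota) (@dl_alpha _ _ _ L);
  dl_alpha_lie :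
    is_lie_hom iota (@dl_bracket _ _ _ L) (D1_bracket f) (@dl_alpha _ _ _ L);
  dl_pi_bimodule :
    is_bimodule_hom (@dl_ract _ _ _ L) (@der_ract _ _ iota) (@dl_pi _ _ _ L);
  dl_pi_lie :
    is_lie_hom iota (@dl_bracket _ _ _ L) (@der_bracket _ _ iota)
      (@dl_pi _ _ _ L);
  dl_proj_alpha : forall u : L, D1_proj (dl_alpha u) = dl_pi u;
  dl_D_central : forall u : L, dl_bracket (dl_D L) u = 0;
  dl_pi_D : dl_pi (dl_D L) = 0;
  dl_ractE : forall (u : L) (c : A),
    dl_ract u c = c *: u + dl_pi u c *: dl_D L;
  dl_leibniz : forall (u v : L) (c : A),
    dl_bracket u (c *: v) = c *: dl_bracket u v + dl_pi u c *: v
}.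

Record is_DLie_hom (k A : comPzRingType) (iota : {rmorphism k -> A})
    (L M : DLie_data iota) (psi : L -> M) : Prop := IsDLieHom {
  dlh_lie : is_lie_hom iota (@dl_bracket _ _ _ L) (@dl_bracket _ _ _ M) psi;
  dlh_bimodule : is_bimodule_hom (@dl_ract _ _ _ L) (@dl_ract _ _ _ M) psi;
  dlh_alpha : forall u, dl_alpha (psi u) = dl_alpha u;
  dlh_D : psi (dl_D L) = dl_D M
}.

Record DLie (k A : comPzRingType) (iota : {rmorphism k -> A})
    (f : Der iota -> Der iota -> A) := MkDLie {
  DLie_val :> DLie_data iota;
  DLieP : is_DLie f DLie_val
}.

Record DLie_hom (k A : comPzRingType) (iota : {rmorphism k -> A})
    (L M : DLie_data iota) := MkDLieHom {
  DLie_hom_fun :> L -> M;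
  DLie_homP : is_DLie_hom DLie_hom_fun
}.

Lemma DLie_hom_ext (k A : comPzRingType) (iota : {rmorphism k -> A})
  (L M : DLie_data iota) (g h : DLie_hom L M) : (forall u, g u = h u) -> g = h.
Proof.
case: g h => [g gP] [h hP] /= /funext egh.
rewrite egh in gP *.
by congr MkDLieHom; apply: Prop_irrelevance.
Qed.

Lemma DLie_id_subproof (k A : comPzRingType) (iota : {rmorphism k -> A})
  (L : DLie_data iota) : @is_DLie_hom k A iota L L id.
Proof. by do !split. Qed.

Lemma DLie_comp_subproof (k A : comPzRingType) (iota : {rmorphism k -> A})
  (L M N : DLie_data iota) (h : DLie_hom M N) (g : DLie_hom L M) :
  is_DLie_hom (h \o g).
Proof.
case: h g => h [[[hD hZ] hB] [hL hR] hA hd] [g [[[gD gZ] gB] [gL gR] gA gd]].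
have hgL : linear (h \o g) by move=> a u v; rewrite /= gL hL.
by do !split=> * //=; rewrite ?(gD, hD, gZ, hZ, gB, hB, gR, hR, hA, gA, gd).
Qed.

Definition DLie_id (k A : comPzRingType) (iota : {rmorphism k -> A})
  (L : DLie_data iota) : DLie_hom L L := MkDLieHom (DLie_id_subproof L).

Definition DLie_comp (k A : comPzRingType) (iota : {rmorphism k -> A})
  (L M N : DLie_data iota) (h : DLie_hom M N) (g : DLie_hom L M) :
  DLie_hom L N := MkDLieHom (DLie_comp_subproof h g).

Definition DLie_cat (k A : comPzRingType) (iota : {rmorphism k -> A})
  (f : Der iota -> Der iota -> A) : category.
Proof.
apply: (@Category (DLie f) (fun L M => DLie_hom L M)
  (fun L => DLie_id L) (fun L M N h g => DLie_comp h g)) => *;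
  exact: DLie_hom_ext.
Defined.

Record LieRinehart (k A : comPzRingType) (iota : {rmorphism k -> A}) :=
  MkLieRinehart {
  lr_sort :> lmodType A;
  lr_bracket : lr_sort -> lr_sort -> lr_sort;
  lr_anchor : lr_sort -> Der iota;
  lr_lie : is_lie_algebra iota lr_bracket;
  lr_anchor_linear : linear lr_anchor;
  lr_anchor_lie : is_lie_hom iota lr_bracket (@der_bracket _ _ iota) lr_anchor;
  lr_leibniz : forall (x y : lr_sort) (a : A),
    lr_bracket x (a *: y) = a *: lr_bracket x y + lr_anchor x a *: y
}.

Record is_LR_hom (k A : comPzRingType) (iota : {rmorphism k -> A})
    (L M : LieRinehart iota) (phi : L -> M) : Prop := IsLRHom {
  lrh_linear : linear phi;
  lrh_lie : is_lie_hom iota (@lr_bracket _ _ _ L) (@lr_bracket _ _ _ M) phi;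
  lrh_anchor : forall x, lr_anchor (phi x) = lr_anchor x
}.

Record LR_hom (k A : comPzRingType) (iota : {rmorphism k -> A})
    (L M : LieRinehart iota) := MkLRHom {
  LR_hom_fun :> L -> M;
  LR_homP : is_LR_hom LR_hom_fun
}.

Lemma LR_hom_ext (k A : comPzRingType) (iota : {rmorphism k -> A})
  (L M : LieRinehart iota) (g h : LR_hom L M) : (forall x, g x = h x) -> g = h.
Proof.
case: g h => [g gP] [h hP] /= /funext egh.
rewrite egh in gP *.
by congr MkLRHom; apply: Prop_irrelevance.
Qed.

Lemma LR_id_subproof (k A : comPzRingType) (iota : {rmorphism k -> A})
  (L : LieRinehart iota) : @is_LR_hom k A iota L L id.
Proof. by do !split. Qed.

Lemma LR_comp_subproof (k A : comPzRingType) (iota : {rmorphism k -> A})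
  (L M N : LieRinehart iota) (h : LR_hom M N) (g : LR_hom L M) :
  is_LR_hom (h \o g).
Proof.
case: h g => h [hL [[hD hZ] hB] hA] [g [gL [[gD gZ] gB] gA]].
have hgL : linear (h \o g) by move=> a u v; rewrite /= gL hL.
by do !split=> * //=; rewrite ?(gD, hD, gZ, hZ, gB, hB, hA, gA).
Qed.

Definition LR_id (k A : comPzRingType) (iota : {rmorphism k -> A})
  (L : LieRinehart iota) : LR_hom L L := MkLRHom (LR_id_subproof L).

Definition LR_comp (k A : comPzRingType) (iota : {rmorphism k -> A})
  (L M N : LieRinehart iota) (h : LR_hom M N) (g : LR_hom L M) :
  LR_hom L N := MkLRHom (LR_comp_subproof h g).

Definition LR_cat (k A : comPzRingType) (iota : {rmorphism k -> A}) : category.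
Proof.
apply: (@Category (LieRinehart iota) (@LR_hom k A iota)
  (@LR_id k A iota) (@LR_comp k A iota)) => *;
  exact: LR_hom_ext.
Defined.

(* L(alpha^*(f)): the pair (a, x) stands for az + x *)

Definition ext (k A : comPzRingType) (iota : {rmorphism k -> A})
  (L : LieRinehart iota) : lmodType A := (A^o * L)%type.

Definition ext_ract (k A : comPzRingType) (iota : {rmorphism k -> A})
  (L : LieRinehart iota) (u : ext L) (b : A) : ext L :=
  (u.1 * b + lr_anchor u.2 b, b *: u.2).

Definition ext_bracket (k A : comPzRingType) (iota : {rmorphism k -> A})
  (f : Der iota -> Der iota -> A) (L : LieRinehart iota) (u v : ext L) :
  ext L :=
  (lr_anchor u.2 v.1 - lr_anchor v.2 u.1
     + pullback (@lr_anchor _ _ _ L) f u.2 v.2,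
   lr_bracket u.2 v.2).

Definition ext_alpha (k A : comPzRingType) (iota : {rmorphism k -> A})
  (L : LieRinehart iota) (u : ext L) : D1 iota := (u.1, lr_anchor u.2).

Definition ext_pi (k A : comPzRingType) (iota : {rmorphism k -> A})
  (L : LieRinehart iota) (u : ext L) : Der iota := lr_anchor u.2.

Definition ext_z (k A : comPzRingType) (iota : {rmorphism k -> A})
  (L : LieRinehart iota) : ext L := (1, 0).

Definition ext_data (k A : comPzRingType) (iota : {rmorphism k -> A})
  (f : Der iota -> Der iota -> A) (L : LieRinehart iota) : DLie_data iota :=
  {| dl_sort := ext L;
     dl_ract := @ext_ract k A iota L;
     dl_alpha := @ext_alpha k A iota L;
     dl_pi := @ext_pi k A iota L;
     dl_bracket := @ext_bracket k A iota f L;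
     dl_D := ext_z L |}.

Definition ext_map (k A : comPzRingType) (iota : {rmorphism k -> A})
  (L M : LieRinehart iota) (phi : L -> M) (u : ext L) : ext M :=
  (u.1, phi u.2).

(* Main.v *)
Require Import Defs.
From HB Require Import structures.
From mathcomp Require Import all_boot all_algebra.
From mathcomp Require Import boolp ring.

Set Implicit Arguments.
Unset Strict Implicit.
Unset Printing Implicit Defensive.

Import GRing.Theory.
Local Open Scope ring_scope.

(** The bracket on Az + L is alternating because f is. In the Jacobi sum of
    az + x, bz + y, cz + w the terms in a, b, c cancel because the anchor is a
    Lie map, and the remaining z-component is the cyclic form of the cocycle
    identity for the pull back of f. The right action is associative
    because the anchor takes values in derivations, and k acts equally on both
    sides because derivations kill the image of k. *)

(** * Elementary identities for a derivation of A over k *)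

Section Derivations.

Variables (k A : comPzRingType) (iota : {rmorphism k -> A}) (x : Der iota).

Lemma der_appD (a b : A) : x (a + b) = x a + x b.
Proof. exact: (derivationD (derP x)). Qed.

Lemma der_appM (a b : A) : x (a * b) = x a * b + a * x b.
Proof. exact: (derivationM (derP x)). Qed.

Lemma der_app_iotaM (c : k) (a : A) : x (iota c * a) = iota c * x a.
Proof. exact: (derivationZ (derP x)). Qed.

Lemma der_app0 : x 0 = 0.
Proof. by apply: (addrI (x 0)); rewrite -der_appD !addr0. Qed.

Lemma der_appN (a : A) : x (- a) = - x a.
Proof. by apply: (addrI (x a)); rewrite -der_appD !subrr der_app0. Qed.

Lemma der_app1 : x 1 = 0.
Proof.
(* The Leibniz rule at 1 * 1 reads x 1 = x 1 + x 1. *)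
by apply: (addrI (x 1)); have := der_appM 1 1; rewrite !mulr1 mul1r addr0.
Qed.

Lemma der_app_iota (c : k) : x (iota c) = 0.
Proof. by have := der_app_iotaM c 1; rewrite mulr1 der_app1 mulr0. Qed.

End Derivations.

(** Scalars of k act through [iota]. This bridges the A-linearity of module maps and the k-linearity
    asked of Lie maps. *)
Lemma linear_klinear (k A : comPzRingType) (iota : {rmorphism k -> A})
  (V W : lmodType A) (g : V -> W) : linear g -> klinear iota g.
Proof.
move=> gL.
have gD u v : g (u + v) = g u + g v by have := gL 1 u v; rewrite !scale1r.
have g0 : g 0 = 0 by apply: (addrI (g 0)); rewrite -gD !addr0.
by split=> [|c u]; [exact: gD | have := gL (iota c) u 0; rewrite g0 !addr0].
Qed.

(** * Calculus of alternating 2-cocycles *)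

Section Cocycles.

Variables (k A : comPzRingType) (iota : {rmorphism k -> A}) (V : lmodType A).
Variables (br : V -> V -> V) (alpha : V -> Der iota) (f : V -> V -> A).
Hypothesis hf : Z2 br alpha f.

Lemma Z2_addl x y z : f (x + y) z = f x z + f y z.
Proof. by have := Z2_linearl hf z 1 x y; rewrite scale1r mul1r. Qed.

Lemma Z2_addr x y z : f x (y + z) = f x y + f x z.
Proof. by have := Z2_linearr hf x 1 y z; rewrite scale1r mul1r. Qed.

Lemma Z2_0l y : f 0 y = 0.
Proof. by apply: (addrI (f 0 y)); rewrite -Z2_addl !addr0. Qed.

Lemma Z2_0r x : f x 0 = 0.
Proof. by apply: (addrI (f x 0)); rewrite -Z2_addr !addr0. Qed.

Lemma Z2_scalel c x y : f (c *: x) y = c * f x y.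
Proof. by have := Z2_linearl hf y c x 0; rewrite Z2_0l !addr0. Qed.

Lemma Z2_scaler c x y : f x (c *: y) = c * f x y.
Proof. by have := Z2_linearr hf x c y 0; rewrite Z2_0r !addr0. Qed.

(** Polarization of f(x + y, x + y) = 0, valid in every characteristic. *)
Lemma Z2_antisym x y : f x y = - f y x.
Proof.
have := Z2_alternating hf (x + y).
rewrite Z2_addl !Z2_addr !(Z2_alternating hf) add0r addr0 => /eqP.
by rewrite addr_eq0 => /eqP.
Qed.

Lemma Z2_oppr x y : f x (- y) = - f x y.
Proof. by apply: (addrI (f x y)); rewrite -Z2_addr !subrr Z2_0r. Qed.

(** Antisymmetry of f and of the bracket absorbs all signs; inner brackets move to the second
    argument, where they stand in the Jacobi sum. *)
Lemma Z2_cocycle_cyclic x y z : (forall u v, br u v = - br v u) ->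
  alpha x (f y z) + alpha y (f z x) + alpha z (f x y)
  + f x (br y z) + f y (br z x) + f z (br x y) = 0.
Proof.
move=> brN; rewrite -(Z2_cocycle hf x y z).
rewrite (Z2_antisym (br x y) z) (Z2_antisym (br x z) y) (Z2_antisym (br y z) x).
by rewrite (brN x z) Z2_oppr (Z2_antisym x z) der_appN; ring.
Qed.

End Cocycles.

Section Extension.

Variables (k A : comPzRingType) (iota : {rmorphism k -> A}).

(** This and the next two equations hold by computation; they let [rewrite] evaluate the module
    operations of [Der iota] pointwise. *)
Lemma der_addE (x y : Der iota) (a : A) : (x + y) a = x a + y a.
Proof. by []. Qed.

Lemma der_scaleE (c : A) (x : Der iota) (a : A) : (c *: x) a = c * x a.
Proof. by []. Qed.

Lemma der_zeroE (a : A) : (0 : Der iota) a = 0.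
Proof. by []. Qed.

(** * Anchor and bracket of a Lie-Rinehart algebra *)

Section Anchor.

Variable L : LieRinehart iota.

Lemma anchorD (x y : L) : lr_anchor (x + y) = lr_anchor x + lr_anchor y.
Proof. by have := @lr_anchor_linear _ _ _ L 1 x y; rewrite !scale1r. Qed.

Lemma anchor0 : lr_anchor (0 : L) = 0.
Proof. by apply: (addrI (lr_anchor (0 : L))); rewrite -anchorD !addr0. Qed.

Lemma anchorZ c (x : L) : lr_anchor (c *: x) = c *: lr_anchor x.
Proof. by have := @lr_anchor_linear _ _ _ L c x 0; rewrite anchor0 !addr0. Qed.

Lemma anchor_bracket (x y : L) :
  lr_anchor (lr_bracket x y) = der_bracket (lr_anchor x) (lr_anchor y).
Proof. by have [_ ->] := lr_anchor_lie L. Qed.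

Lemma lr_bracketDl (x y z : L) :
  lr_bracket (x + y) z = lr_bracket x z + lr_bracket y z.
Proof. exact: (lie_linearl (lr_lie L) z).1. Qed.

Lemma lr_bracketDr (x y z : L) :
  lr_bracket x (y + z) = lr_bracket x y + lr_bracket x z.
Proof. exact: (lie_linearr (lr_lie L) x).1. Qed.

Lemma lr_bracket0l (x : L) : lr_bracket 0 x = 0.
Proof. by apply: (addrI (lr_bracket 0 x)); rewrite -lr_bracketDl !addr0. Qed.

Lemma lr_bracket_antisym (x y : L) : lr_bracket x y = - lr_bracket y x.
Proof.
have := lie_alternating (lr_lie L) (x + y).
rewrite lr_bracketDl !lr_bracketDr !(lie_alternating (lr_lie L)) add0r addr0.
by move=> /eqP; rewrite addr_eq0 => /eqP.
Qed.

End Anchor.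

(** * The extension by a pulled back cocycle, and its maps *)

Variable f : Der iota -> Der iota -> A.
Hypothesis hf : Z2 (@der_bracket k A iota) id f.

(** The anchor is A-linear and respects brackets, so each clause is that of f evaluated at
    anchors. *)
Lemma pullback_Z2 (L : LieRinehart iota) :
  Z2 (@lr_bracket k A iota L) (@lr_anchor k A iota L)
     (pullback (@lr_anchor k A iota L) f).
Proof.
split=> [y a x x'|x a y y'|x|x y z]; rewrite /pullback.
- by rewrite anchorD anchorZ (Z2_addl hf) (Z2_scalel hf).
- by rewrite anchorD anchorZ (Z2_addr hf) (Z2_scaler hf).
- exact: (Z2_alternating hf).
- by rewrite !anchor_bracket; exact: (Z2_cocycle hf).
Qed.

Lemma ext_is_bimodule (L : LieRinehart iota) :
  is_bimodule iota (@ext_ract k A iota L).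
Proof.
split=> [[a x] [b y] c|[a x] c d|[a x]|[a x] c d|c [a x] d|c [a x]];
  congr pair => //=.
- by rewrite anchorD der_addE; ring.
- by rewrite scalerDr.
- by rewrite der_appD; ring.
- by rewrite scalerDl.
- by rewrite der_app1; ring.
- by rewrite scale1r.
(* Acting by c scales the anchor by c, and its value at d supplies the second Leibniz term of
   x(cd). *)
- by rewrite anchorZ der_scaleE der_appM; ring.
- by rewrite mulrC scalerA.
(* [ring] sees scaling on [A^o] as a product only after unfolding. *)
- by rewrite anchorZ der_scaleE /GRing.scale /=; ring.
- by rewrite !scalerA mulrC.
- by rewrite der_app_iota /GRing.scale /=; ring.
Qed.

Lemma ext_is_lie_algebra (L : LieRinehart iota) :
  is_lie_algebra iota (@ext_bracket k A iota f L).
Proof.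
have hL := pullback_Z2 L; have lieL := lr_lie L.
split=> [[b y]|[a x]|[a x]|[a x] [b y] [c z]].
- split=> [[a x] [a' x']|c [a x]]; congr pair => /=.
  + by rewrite anchorD der_addE der_appD (Z2_addl hL); ring.
  + exact: lr_bracketDl.
  (* The scalar must leave the argument of the derivation attached to y, which [iota c] does without
     a Leibniz term. *)
  + rewrite anchorZ der_scaleE (Z2_scalel hL) /GRing.scale /= der_app_iotaM.
    by ring.
  + exact: (lie_linearl lieL y).2.
- split=> [[b y] [b' y']|c [b y]]; congr pair => /=.
  + by rewrite anchorD der_addE der_appD (Z2_addr hL); ring.
  + exact: lr_bracketDr.
  + rewrite anchorZ der_scaleE (Z2_scaler hL) /GRing.scale /= der_app_iotaM.
    by ring.
  + exact: (lie_linearr lieL x).2.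
- congr pair => /=; last exact: (lie_alternating lieL).
  by rewrite (Z2_alternating hL) subrr addr0.
- congr pair => /=; last exact: (lie_jacobi lieL).
  rewrite !anchor_bracket /= !der_appD !der_appN.
  by rewrite -(Z2_cocycle_cyclic hL x y z (@lr_bracket_antisym L)); ring.
Qed.

Lemma ext_is_DLie (L : LieRinehart iota) : is_DLie f (ext_data f L).
Proof.
have hL := pullback_Z2 L.
have alphaL : linear (@ext_alpha k A iota L).
  by move=> c [a x] [b y]; congr pair; rewrite /= anchorD anchorZ.
have piL : linear (@ext_pi k A iota L).
  by move=> c [a x] [b y]; rewrite /ext_pi /= anchorD anchorZ.
split=> /=.
- exact: ext_is_bimodule.
- exact: ext_is_lie_algebra.
- by split=> // [[a x] c]; congr pair; rewrite /= anchorZ.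
- split=> [|[a x] [b y]]; first exact: linear_klinear.
  by congr pair; rewrite /= anchor_bracket.
- by split=> // [[a x] c]; rewrite /ext_pi /= anchorZ.
- split=> [|[a x] [b y]]; first exact: linear_klinear.
  by rewrite /ext_pi /= anchor_bracket.
- by [].
(* z is (1, 0): its anchor is 0, derivations kill 1, and the cocycle vanishes at 0. *)
- move=> [a x]; congr pair => /=; last exact: lr_bracket0l.
  by rewrite anchor0 der_zeroE der_app1 (Z2_0l hL) subr0 addr0.
- exact: anchor0.
- move=> [a x] c; congr pair => /=; last by rewrite scaler0 addr0.
  by rewrite /ext_pi /GRing.scale /=; ring.
(* Expanding x(cb) produces the extra x(c)b along z. *)
- move=> [a x] [b y] c; congr pair => /=; last exact: lr_leibniz.
  rewrite anchorZ der_scaleE (Z2_scaler hL) /ext_pi /GRing.scale /= der_appM.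
  by ring.
Qed.

(** The z-coordinates of the bracket and of the right action depend on L only through anchors, which
    phi preserves. *)
Lemma ext_map_is_DLie_hom (L L' : LieRinehart iota) (phi : LR_hom L L') :
  is_DLie_hom (L := ext_data f L) (M := ext_data f L') (ext_map phi).
Proof.
case: phi => phi [phiL [[phiD phiZ] phiB] phiA] /=.
(* Serves both to extract scaling from [phiL] and to send z = (1, 0) to z'. *)
have phi0 : phi 0 = 0 by apply: (addrI (phi 0)); rewrite -phiD !addr0.
have mapL : linear (@ext_map k A iota L L' phi).
  by move=> c [a x] [b y]; congr pair; rewrite /= phiL.
split=> [||[a x]|].
- split=> [|[a x] [b y]]; first exact: linear_klinear.
  by congr pair; rewrite /= /pullback ?phiA ?phiB.
- split=> // [[a x] c]; congr pair; rewrite /= ?phiA //.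
  by have := phiL c x 0; rewrite phi0 !addr0.
- by congr pair; rewrite /= phiA.
- by congr pair.
Qed.

End Extension.

Theorem theorem2p7 (k A : comPzRingType) (iota : {rmorphism k -> A})
  (f : Der iota -> Der iota -> A) (hf : Z2 (@der_bracket k A iota) id f) :
  (forall L : LieRinehart iota,
     Z2 (@lr_bracket k A iota L) (@lr_anchor k A iota L)
        (pullback (@lr_anchor k A iota L) f)) /\
  exists (HF : forall L : LieRinehart iota, is_DLie f (ext_data f L))
         (HM : forall (L L' : LieRinehart iota) (phi : LR_hom L L'),
             is_DLie_hom (L := ext_data f L) (M := ext_data f L')
               (ext_map phi)),
    is_functor (C := LR_cat iota) (D := DLie_cat f)
      (F0 := fun L => MkDLie (HF L))
      (fun L L' phi => MkDLieHom (HM L L' phi)) /\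
    (forall (L L' : LieRinehart iota) (phi : LR_hom L L'),
       ext_map phi (ext_z L) = ext_z L') /\
    (forall (L L' L'' : LieRinehart iota)
            (phi : LR_hom L L') (phi' : LR_hom L' L''),
       ext_map (LR_comp phi' phi) = ext_map phi' \o ext_map phi).
Proof.
split; first exact: pullback_Z2.
exists (ext_is_DLie hf), (ext_map_is_DLie_hom f); split.
  (* Equality of morphisms is pointwise, and both functor laws compute on pairs. *)
  by split=> [L|L L' L'' psi phi]; apply: DLie_hom_ext => -[a x].
split=> [L L' phi|//].
exact: (dlh_D (ext_map_is_DLie_hom f phi)).
Qed.
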